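(* Let $1<p<2$ and $c_p=(p-1)^{\frac{p-1}{p}}(2-p)^{\frac{2-p}{p}}$. Let $b_j(p)=2\int_0^1\cos_p(\pi_p x)\cos(j\pi x)\,dx$. Then $$|b_j(p)|<\frac{8\pi_p}{j^2\pi^2}\,c_p\qquad\text{for all integers } j\ge 1.$$
   Context: For $1<p<\infty$ let $F_p(y)=\int_0^y(1-t^p)^{-1/p}\,dt$ for $y\in[0,1]$, and $\pi_p:=2F_p(1)=\frac{2\pi}{p\sin(\pi/p)}$. The function $\sin_p:[0,\frac{\pi_p}{2}]\to[0,1]$ is the inverse of $F_p$, extended to $\mathbb{R}$ by $\sin_p(-x)=-\sin_p(x)$ and $\sin_p(\frac{\pi_p}{2}-x)=\sin_p(\frac{\pi_p}{2}+x)$ (so it is $2\pi_p$-periodic). Define $\cos_p x:=\frac{d}{dx}\sin_p x$ for all $x\in\mathbb{R}$. *)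

(* Defs.v *)
From HB Require Import structures.
From mathcomp Require Import all_boot all_order all_algebra.
From mathcomp Require Import all_classical all_reals all_analysis.
From mathcomp Require Import lra.

Set Implicit Arguments.
Unset Strict Implicit.
Unset Printing Implicit Defensive.

Import Order.TTheory GRing.Theory Num.Theory.
Import numFieldNormedType.Exports.

Local Open Scope classical_set_scope.
Local Open Scope ring_scope.

Section GeneralizedTrigonometry.
Context {R : realType}.
Implicit Types (p x y : R) (j : nat).

(* For y = 1 the integrand is unbounded; the Lebesgue integral agrees with the
   improper Riemann integral. The integrand takes the value [0 `^ _ = 0] at
   t = 1, which is irrelevant to the integral. *)
Definition arcsinp p y : R :=
  \int[lebesgue_measure]_(t in `[0, y]) (1 - t `^ p) `^ (- p^-1).

Definition pip p : R := 2 * arcsinp p 1.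

(* Inverse of [arcsinp p : [0, 1] -> [0, pip p / 2]]; only its values on
   [0, pip p / 2] are meaningful. *)
Definition sinp_fund p x : R := 'pinv_(fun=> 0) `[0, 1] (arcsinp p) x.

(* Extension to the real line by oddness and by reflection at [pip p / 2].
   Together these two symmetries give sin_p (x + pi_p) = - sin_p x, so that
   sin_p x = (-1)^k sin_p r for x = k pi_p + r with -pi_p/2 <= r < pi_p/2. *)
Definition sinp p x : R :=
  let k := Num.floor (x / pip p + 2^-1) in
  let r := x - k%:~R * pip p in
  (-1) ^ k * (Num.sg r * sinp_fund p `|r|).

Definition cosp p : R -> R := derive1 (sinp p).

Definition cp p : R :=
  (p - 1) `^ ((p - 1) / p) * (2 - p) `^ ((2 - p) / p).

Definition bcoef j p : R :=
  2 * \int[lebesgue_measure]_(x in `[0, 1])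
        (cosp p (pip p * x) * cos (j%:R * pi * x)).

Lemma sinp_shift p x (m : int) : 0 < pip p ->
  sinp p (x + m%:~R * pip p) = (-1) ^ m * sinp p x.
Proof.
move=> p0; rewrite /sinp.
have -> : (x + m%:~R * pip p) / pip p + 2^-1 = (x / pip p + 2^-1) + m%:~R.
  by rewrite mulrDl mulfK ?gt_eqF // addrAC.
rewrite floorDrz ?intr_int // intrKfloor.
set k := Num.floor _.
have -> : x + m%:~R * pip p - (k + m)%:~R * pip p = x - k%:~R * pip p.
  by rewrite intrD mulrDl; lra.
by rewrite [RHS]mulrA -expfzDr ?oppr_eq0 ?oner_eq0 // [(m + k)%R]addrC.
Qed.

Lemma sinp_sym p x : 0 < pip p -> `|x| <= pip p / 2 ->
  sinp p x = Num.sg x * sinp_fund p `|x|.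
Proof.
move=> p0; rewrite ler_norml => /andP[xl xr].
have [xlt|xge] := ltP x (pip p / 2).
  rewrite /sinp; have -> : Num.floor (x / pip p + 2^-1) = 0.
    apply: floor_def; rewrite add0r.
    have -> : x / pip p + 2^-1 = (x + pip p / 2) / pip p.
      by rewrite mulrDl -mulrA [_^-1 * _]mulrC mulrA divff ?gt_eqF // mul1r.
    rewrite ler_pdivlMr // ltr_pdivrMr // mul0r mul1r; apply/andP; split; lra.
  by rewrite expr0z mul1r mul0r subr0.
have {xl xr xge} -> : x = pip p / 2 by lra.
rewrite /sinp.
have -> : pip p / 2 / pip p + 2^-1 = 1.
  by rewrite mulrAC divff ?gt_eqF // mul1r; lra.
rewrite floor1 mul1r.
have -> : pip p / 2 - pip p = - (pip p / 2) by lra.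
by rewrite expr1z sgrN normrN !mulNr mul1r opprK.
Qed.

Lemma sinp_eq_fund p x : 0 < pip p -> 0 < x <= pip p / 2 ->
  sinp p x = sinp_fund p x.
Proof.
move=> p0 /andP[x0 xp]; rewrite sinp_sym ?gtr0_norm // gtr0_sg // mul1r //.
Qed.

Lemma sinpN p x : 0 < pip p -> sinp p (- x) = - sinp p x.
Proof.
move=> p0; pose k := Num.floor (x / pip p + 2^-1).
pose r := x - k%:~R * pip p.
have rp : `|r| <= pip p / 2.
  have /andP[kl kr] := floor_itv (x / pip p + 2^-1).
  rewrite -/k in kl kr; rewrite intrD in kr.
  have xE : x = x / pip p * pip p by rewrite divfK ?gt_eqF.
  rewrite /r {1}xE; set z := x / pip p in kl kr *.
  rewrite -mulrBl normrM (gtr0_norm p0) mulrC ler_pM2l // ler_norml.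
  by apply/andP; split; lra.
have xE : x = r + k%:~R * pip p by rewrite /r subrK.
have NxE : - x = - r + (- k)%:~R * pip p by rewrite {1}xE opprD intrN mulNr.
rewrite NxE sinp_shift // {1}xE sinp_shift // !sinp_sym ?normrN //.
rewrite sgrN mulNr mulrN; congr (- (_ * _)).
by rewrite -exprz_inv invrN invr1.
Qed.

Lemma sinp_reflect p x : 0 < pip p ->
  sinp p (pip p / 2 - x) = sinp p (pip p / 2 + x).
Proof.
move=> p0.
have -> : pip p / 2 + x = - (pip p / 2 - x) + 1%:~R * pip p by lra.
by rewrite sinp_shift // sinpN // expr1z mulrNN mul1r.
Qed.

End GeneralizedTrigonometry.

(* Main.v *)
(* On [0, 1/2] the function f(x) = cos_p(pi_p x) satisfies f' = - pi_p h with
   h = K(sin_p(pi_p x)) and K(y) = y^(p-1) (1 - y^p)^((2-p)/p). The function K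
   vanishes at 0 and 1, increases up to its maximum cp p at y = (p-1)^(1/p) and
   decreases afterwards. Two integrations by parts express the integral of
   f(x) cos(omega x) over [0, 1/2] through that of h'(x) cos(omega x), which is
   less than the total variation 2 cp p of h since |cos| <= 1, strictly near 0.
   As h' is unbounded, the integrations by parts are replaced by differentiating
   in y = sin_p(pi_p x) a boundary term minus the primitive and comparing the
   result with K by the mean value theorem. Reflection at 1/2 handles the other
   half of [0, 1]. *)
Require Import Defs.
From HB Require Import structures.
From mathcomp Require Import all_boot all_order all_algebra.
From mathcomp Require Import all_classical all_reals all_analysis.
From mathcomp Require Import measurable_realfun ring lra.

Import Order.TTheory GRing.Theory Num.Theory.
Import numFieldNormedType.Exports.
Local Open Scope classical_set_scope.
Local Open Scope ring_scope.

(** * Real powers: continuity, derivatives, integrability of a power of 1 - x *)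

Section powR_regularity.
Context {R : realType}.
Implicit Types (p q x y : R).
Local Notation mu := (@lebesgue_measure R).

(* The norm is needed because of the junk value [x `^ q = 1] for [x < 0]. *)
Lemma continuous_norm_powR q : 0 < q -> continuous (fun x : R => `|x| `^ q).
Proof.
move=> q0 x; have [->|x0] := eqVneq x 0.
  rewrite /continuous_at normr0 powR0 ?gt_eqF//.
  apply/cvgrPdist_lt => e e0; near=> y.
  rewrite sub0r normrN ger0_norm ?powR_ge0//.
  rewrite -[ltRHS]powRr1 ?(ltW e0)// -(mulVf (lt0r_neq0 q0)) powRrM.
  rewrite gt0_ltr_powR ?nnegrE ?powR_ge0//.
  near: y; exists (e `^ q^-1); first exact: powR_gt0.
  by move=> y; rewrite /= sub0r normrN.
have c : {for `|x|, continuous (fun y : R => y `^ q)}.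
  apply/differentiable_continuous/derivable1_diffP/derivable_powR.
  by rewrite in_itv/= andbT normr_gt0.
exact: (continuous_comp (@norm_continuous R R x) c).
Unshelve. all: by end_near. Qed.

Lemma is_derive_onem_powR q y : y < 1 ->
  is_derive y 1 (fun x => (1 - x) `^ q) (- (q * (1 - y) `^ (q - 1))).
Proof.
move=> y1.
have h : is_derive (1 - y) 1 (fun x : R => x `^ q) (q * (1 - y) `^ (q - 1)).
  by apply: is_derive1_powR; rewrite subr_gt0.
apply: is_derive_eq; first exact: is_derive1_comp.
by ring.
Qed.

(** For q < 1 the integrand blows up at 1. The primitive -(1 - x)^q / q bounds the integral over
    [0, c] by 1/q for every c < 1, and monotone convergence carries this bound to [0, 1[. *)
Lemma integrable_onem_powR q : 0 < q ->
  mu.-integrable `[0, 1] (EFin \o (fun x => (1 - x) `^ (q - 1))).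
Proof.
move=> q0; set f := fun x => _.
have mf (D : set R) : measurable_fun D f.
  apply: measurable_funTS.
  have m1 : measurable_fun setT (fun x : R => 1 - x) by exact: measurable_funB.
  exact: (measurableT_comp (measurable_powR (q - 1)) m1).
have bF (c : R) : (0 < c < 1)%R -> (\int[mu]_(x in `[0%R, c]) (f x)%:E <= q^-1%:E)%E.
  move=> /andP[c0 c1].
  pose G x := - (1 - x) `^ q / q.
  have dG (x : R) : x < 1 -> is_derive x 1 G (f x).
    move=> x1; have h := is_derive_onem_powR q x x1.
    rewrite /G /f; apply: is_derive_eq.
    by rewrite /= !scaler0 ?addr0 ?add0r -[_ *: _]/(_ * _); field; rewrite gt_eqF.
  have dd (x : R) : x < 1 -> derivable G x 1 by move=> /dG[].
  have cc (x : R) : x < 1 -> {for x, continuous G}.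
    by move=> /dd x1; exact/differentiable_continuous/derivable1_diffP.
  rewrite (@continuous_FTC2 _ f G)//.
  - rewrite -EFinB lee_fin.
    have -> : G c - G 0 = q^-1 - (1 - c) `^ q / q by rewrite /G subr0 powR1; lra.
    by rewrite lerBlDr lerDl mulr_ge0 ?powR_ge0// invr_ge0 ltW.
  - apply: continuous_in_subspaceT => x; rewrite inE/= in_itv/= => /andP[_ xc].
    apply/differentiable_continuous/derivable1_diffP/ex_derive.
    by apply: is_derive_onem_powR; exact: le_lt_trans xc c1.
  - split.
    + by move=> x; rewrite in_itv/= => /andP[_ xc]; apply: dd; exact: lt_trans xc c1.
    + by apply: cvg_at_right_filter; apply: cc.
    + by apply: cvg_at_left_filter; apply: cc.
  - move=> x; rewrite in_itv/= => /andP[_ xc]; rewrite derive1E.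
    by have [_ ->] := dG x (lt_trans xc c1).
have inv01 n : 0 < (n.+2%:R^-1 : R) < 1.
  by rewrite invr_gt0 ltr0n invf_lt1 ?ltr1n// ltr0n.
(* The shift by 2 keeps every right endpoint strictly between 0 and 1, as [bF] requires. *)
pose F (n : nat) : set R := `[0, 1 - n.+2%:R^-1]%classic.
have UF : \bigcup_n F n = `[0, 1[%classic.
  apply/seteqP; split => x /=.
    move=> [n _]; rewrite /F/= !in_itv/= => /andP[-> /le_lt_trans] /=; apply.
    by rewrite gtrDl oppr_lt0 invr_gt0 ltr0n.
  rewrite in_itv/= => /andP[x0 x1].
  have x1' : 0 < 1 - x by rewrite subr_gt0.
  have /= [N _ /(_ N (leqnn N)) /= Nx] := near_infty_natSinv_lt (PosNum x1').
  exists N => //; rewrite /F/= in_itv/= x0/= lerBrDr -lerBrDl (le_trans _ (ltW Nx))//.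
  by rewrite lef_pV2 ?posrE ?ltr0n// ler_nat.
have nF : nondecreasing_seq F.
  move=> m n mn; rewrite subsetEset /F; apply: subset_itvl; rewrite bnd_simp.
  by rewrite lerB// lef_pV2 ?posrE ?ltr0n// ler_nat !ltnS.
have f0 x : 0 <= f x by exact: powR_ge0.
apply/integrableP; split; first by apply/measurable_EFinP; exact: mf.
under eq_integral => x _ do rewrite /= ger0_norm//.
rewrite -integral_itv_bndo_bndc; last by apply/measurable_EFinP; exact: mf.
rewrite -UF.
have cvgF : (\int[mu]_(x in F i) (f x)%:E @[i --> \oo] -->
             \int[mu]_(x in \bigcup_i F i) (f x)%:E)%E.
  apply: ge0_nondecreasing_set_cvg_integral => //.
  - by move=> n; exact: measurable_itv.
  - by move=> n; apply/measurable_EFinP; exact: mf.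
  - by move=> n x _; rewrite lee_fin.
rewrite -(cvg_lim _ cvgF)//; apply: (@le_lt_trans _ _ q^-1%:E); last exact: ltry.
apply: lime_le; first by apply/cvg_ex; eexists; exact: cvgF.
by apply: nearW => n; apply: bF; have /andP[i0 i1] := inv01 n;
  rewrite subr_gt0 i1 ltrBlDr ltrDl.
Qed.
End powR_regularity.

(** * The function F_p on [0, 1] and its inverse *)

Section arcsinp_theory.
Context {R : realType}.
Variable p : R.
Hypothesis p1 : 1 < p.
Implicit Types (q x y : R).
Local Notation mu := (@lebesgue_measure R).

Let p0 : 0 < p. Proof. exact: lt_trans ltr01 p1. Qed.
Let powR1p : 1 `^ p = 1 :> R. Proof. by rewrite powR1. Qed.

Lemma powR_lt1 y : 0 <= y < 1 -> y `^ p < 1.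
Proof.
move=> /andP[y0 y1].
by rewrite -[ltRHS]powR1p gt0_ltr_powR// nnegrE// ler01.
Qed.

Lemma is_derive_onem_powR_powR q y : 0 < y < 1 ->
  is_derive y 1 (fun x => (1 - x `^ p) `^ q)
    (- (p * q * y `^ (p - 1) * (1 - y `^ p) `^ (q - 1))).
Proof.
move=> /andP[y0 y1].
have h : is_derive (y `^ p) 1 (fun x : R => (1 - x) `^ q)
    (- (q * (1 - y `^ p) `^ (q - 1))).
  by apply: is_derive_onem_powR; rewrite powR_lt1// (ltW y0).
have h2 := is_derive1_powR p y0.
by apply: is_derive_eq; [exact: (@is_derive1_comp _ _ (fun x : R => x `^ p) _ _ _ h h2)|ring].
Qed.

(** With absolute values around both bases the function is continuous on the whole line, and on
    [0, 1] both bases are nonnegative, so the absolute values disappear. *)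
Lemma continuous_onem_powR_powR q : 0 < q ->
  {within `[0, 1], continuous (fun x => (1 - x `^ p) `^ q)}.
Proof.
move=> q0.
have c : continuous (fun x : R => `|1 - `|x| `^ p| `^ q).
  move=> x.
  apply: (@continuous_comp _ _ _ (fun x : R => 1 - `|x| `^ p) (fun y => `|y| `^ q)).
    apply: continuousB; first exact: cst_continuous.
    exact: continuous_norm_powR.
  exact: continuous_norm_powR.
have : {within `[0, 1], continuous (fun x : R => `|1 - `|x| `^ p| `^ q)}
  by exact: continuous_subspaceT c.
apply: subspace_eq_continuous => x /=; rewrite inE/= in_itv/= => /andP[x0 x1].
rewrite /from_subspace (ger0_norm x0) ger0_norm// subr_ge0.
by rewrite -[leRHS]powR1p ge0_ler_powR ?nnegrE// ltW.
Qed.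

Lemma continuous_powR_itv q : 0 < q -> {within `[0, 1], continuous (fun x : R => x `^ q)}.
Proof.
move=> q0; have c := continuous_norm_powR _ q0.
have : {within `[0, 1], continuous (fun x : R => `|x| `^ q)}
  by exact: continuous_subspaceT c.
apply: subspace_eq_continuous => x /=; rewrite inE/= in_itv/= => /andP[x0 x1].
by rewrite /from_subspace (ger0_norm x0).
Qed.

Let w (t : R) : R := (1 - t `^ p) `^ (- p^-1).

(** Since t^p <= t on [0, 1], the integrand is dominated by (1 - t)^(-1/p), whose exponent is q - 1
    with q = 1 - 1/p > 0. *)
Lemma integrable_arcsinp : mu.-integrable `[0, 1] (EFin \o w).
Proof.
have q0 : 0 < 1 - p^-1 by rewrite subr_gt0 invf_lt1.
have := integrable_onem_powR _ q0; apply: le_integrable => //.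
  apply/measurable_EFinP; apply: measurable_funTS.
  have m1 : measurable_fun setT (fun x : R => 1 - x `^ p).
    exact: measurable_funB.
  exact: (measurableT_comp (measurable_powR (- p^-1)) m1).
move=> x; rewrite /= in_itv/= lee_fin !ger0_norm ?powR_ge0// => /andP[x0].
have -> : 1 - p^-1 - 1 = - p^-1 by lra.
(* At x = 1 both sides take the default value 0 of a nonzero power of 0. *)
rewrite le_eqVlt => /predU1P[->|x1].
  by rewrite /w powR1 subrr !powR0// ?oppr_eq0 ?invr_eq0 ?gt_eqF.
have xp : x `^ p <= x.
  have [->|x0'] := eqVneq x 0; first by rewrite powR0 ?gt_eqF.
  by rewrite ge1r_powR ?ltW// lt_neqAle eq_sym x0' x0.
rewrite /w !powRN lef_pV2 ?posrE ?powR_gt0 ?subr_gt0//; last exact: le_lt_trans xp x1.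
by rewrite ge0_ler_powR ?invr_ge0 ?(ltW p0) ?nnegrE ?subr_ge0// ?lerB//
  ltW// (le_lt_trans xp).
Qed.

Lemma is_derive_arcsinp y : 0 < y < 1 -> is_derive y 1 (arcsinp p) (w y).
Proof.
move=> y01; have /andP[y0 y1] := y01.
have cw : {for y, continuous w}.
  apply/differentiable_continuous/derivable1_diffP.
  by have [] := is_derive_onem_powR_powR (- p^-1) _ y01.
have [d <-] := continuous_FTC1_closed y1 integrable_arcsinp y0 cw.
by rewrite derive1E; exact/derivableP.
Qed.

Lemma arcsinp0 : arcsinp p 0 = 0.
Proof. by rewrite /arcsinp set_itv1 Rintegral_set1. Qed.

Lemma continuous_arcsinp : {within `[0, 1], continuous (arcsinp p)}.
Proof. exact: (parameterized_integral_continuous ler01 integrable_arcsinp). Qed.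

Lemma ltr_arcsinp : {in `[0, 1] &, {homo arcsinp p : x y / x < y}}.
Proof.
move=> x y; rewrite !in_itv/= => /andP[x0 x1] /andP[y0 y1] xy.
have d t : t \in `]x, y[ -> is_derive t 1 (arcsinp p) (w t).
  rewrite in_itv/= => /andP[xt ty]; apply: is_derive_arcsinp.
  by rewrite (le_lt_trans x0 xt) (lt_le_trans ty y1).
have c : {within `[x, y], continuous (arcsinp p)}.
  by apply: continuous_subspaceW continuous_arcsinp; apply: subset_itv; rewrite bnd_simp.
have [t + e] := MVT xy d c; rewrite in_itv/= => /andP[xt ty].
rewrite -subr_gt0 e mulr_gt0 ?subr_gt0// powR_gt0// subr_gt0 powR_lt1//.
by rewrite (le_trans x0 (ltW xt)) (lt_le_trans ty y1).
Qed.

Lemma pip_gt0 : 0 < pip p.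
Proof.
by rewrite /pip mulr_gt0// -arcsinp0 ltr_arcsinp// in_itv/= lexx ler01.
Qed.

Lemma sinp_fundK : {in `[0, 1], cancel (arcsinp p) (sinp_fund p)}.
Proof.
move=> y y01; apply: pinvKV; last by rewrite inE.
move=> a b; rewrite !inE/= => a01 b01 e.
have [ab|ba|//] := ltgtP a b.
  by have := ltr_arcsinp a b a01 b01 ab; rewrite e ltxx.
by have := ltr_arcsinp b a b01 a01 ba; rewrite e ltxx.
Qed.

End arcsinp_theory.

(** * Range, continuity and derivative of sin_p; reflection of cos_p *)

Section sinp_theory.
Context {R : realType}.
Variable p : R.
Hypothesis p1 : 1 < p.
Implicit Types (q x y : R).
Local Notation mu := (@lebesgue_measure R).

Let pip0 : 0 < pip p. Proof. exact: pip_gt0. Qed.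

Lemma arcsinp1 : arcsinp p 1 = pip p / 2.
Proof. by rewrite /pip mulrAC divff ?mul1r. Qed.

Lemma arcsinp_itvoo y : 0 < y < 1 -> 0 < arcsinp p y < pip p / 2.
Proof.
move=> /andP[y0 y1].
have y01 : y \in `[0, 1] by rewrite in_itv/= !ltW.
by rewrite -arcsinp1 -[ltLHS](arcsinp0 p) !ltr_arcsinp// in_itv/= ?lexx ?ler01.
Qed.

(** The intermediate value theorem for [arcsinp p] supplies a preimage in [0, 1]; it is not an
    endpoint, because the endpoints are sent to 0 and [pip p / 2]. *)
Lemma sinp_fund_itvoo x : 0 < x < pip p / 2 ->
  0 < sinp_fund p x < 1 /\ arcsinp p (sinp_fund p x) = x.
Proof.
move=> /andP[x0 x1].
have le01 : arcsinp p 0 <= arcsinp p 1 by rewrite arcsinp0 arcsinp1 ltW// divr_gt0.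
have xin : `[arcsinp p 0, arcsinp p 1]%classic x.
  by rewrite /= arcsinp0 arcsinp1 in_itv/= !ltW.
have [y y01 yx] := segment_continuous_le_surjective ler01 le01 (continuous_arcsinp p p1) xin.
rewrite -yx sinp_fundK//; split => //.
move: y01; rewrite /= in_itv/= !le_eqVlt => /andP[/predU1P[y0|->] /predU1P[y1|->]]//.
- by move: x0; rewrite -yx -y0 arcsinp0 ltxx.
- by move: x0; rewrite -yx -y0 arcsinp0 ltxx.
- by move: x1; rewrite -yx y1 arcsinp1 ltxx.
Qed.

Lemma sinp_fund_itvcc x : 0 <= x <= pip p / 2 -> 0 <= sinp_fund p x <= 1.
Proof.
rewrite !le_eqVlt => /andP[/predU1P[<-|x0] /predU1P[|x1]].
- by move=> e; have := divr_gt0 pip0 (ltr0n R 2); rewrite -e ltxx.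
- by rewrite -[X in sinp_fund p X](arcsinp0 p) sinp_fundK ?in_itv/= ?lexx ?ler01//
    eqxx ltr01 orbT.
- by rewrite -arcsinp1 => ->; rewrite sinp_fundK ?in_itv/= ?lexx ?ler01//
    eqxx ltr01 orbT.
- have x01 : 0 < x < pip p / 2 by rewrite x0.
  by have [/andP[-> ->] _] := sinp_fund_itvoo x x01; rewrite !orbT.
Qed.

(** The inverse of a continuous injection of a segment is continuous. Here the injection is
    [arcsinp p] divided by [pip p], which maps [0, 1] onto [0, 1/2]. *)
Lemma continuous_sinp_fund :
  {within `[0, 2^-1], continuous (fun x => sinp_fund p (pip p * x))}.
Proof.
have K : {in `[0, 1], cancel (fun y => arcsinp p y / pip p)
    (fun x => sinp_fund p (pip p * x))}.
  by move=> y y01; rewrite mulrC divfK ?gt_eqF// sinp_fundK.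
have c : {within `[0, 1], continuous (fun y => arcsinp p y / pip p)}.
  move=> y; apply: cvgM; last exact: cvg_cst.
  exact: continuous_arcsinp.
have := segment_can_le_continuous ler01 c K.
by rewrite arcsinp0 mul0r arcsinp1 mulrAC divff ?gt_eqF// mul1r.
Qed.

(** By the inverse function rule the derivative is the reciprocal of the integrand of [arcsinp];
    [sinp] and [sinp_fund] agree in a neighbourhood of x. *)
Lemma is_derive_sinp x : 0 < x < pip p / 2 ->
  is_derive x 1 (sinp p) ((1 - sinp_fund p x `^ p) `^ p^-1).
Proof.
move=> x01; have [S01 SK] := sinp_fund_itvoo _ x01.
have near01 : \forall y \near sinp_fund p x, 0 < y < 1.
  have := near_in_itvoo S01; apply: filterS => y; by rewrite in_itv.
have nearx : \forall y \near x, 0 < y < pip p / 2.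
  have := near_in_itvoo x01; apply: filterS => y; by rewrite in_itv.
have d := is_derive_arcsinp p p1 _ S01.
have : is_derive (arcsinp p (sinp_fund p x)) 1 (sinp_fund p)
  ((1 - sinp_fund p x `^ p) `^ (- p^-1))^-1.
  apply: is_derive_inverse => //.
  - apply: filterS near01 => y /andP[y0 y1].
    by rewrite sinp_fundK// in_itv/= !ltW.
  - apply: filterS near01 => y y01.
    have [dy _] := is_derive_arcsinp p p1 _ y01.
    exact/differentiable_continuous/derivable1_diffP.
  - rewrite gt_eqF// powR_gt0// subr_gt0 powR_lt1//.
    by have /andP[/ltW -> ->] := S01.
rewrite SK powRN invrK; apply: near_eq_is_derive.
apply: filterS nearx => y /andP[y0 y1].
by rewrite sinp_eq_fund// y0 ltW.
Qed.

Lemma cosp_sinp_fund x : 0 < x < pip p / 2 ->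
  cosp p x = (1 - sinp_fund p x `^ p) `^ p^-1.
Proof. by move=> x01; rewrite /cosp derive1E; have [] := is_derive_sinp x x01. Qed.

(** Differentiate the symmetry sin_p(y) = sin_p(pi_p - y), which is the reflection at pi_p / 2
    recentred. *)
Lemma cosp_reflect x : 0 < x < pip p / 2 -> cosp p (pip p - x) = - cosp p x.
Proof.
move=> x01.
have e : sinp p = sinp p \o (fun y => pip p - y).
  apply/funext => y /=.
  have -> : y = pip p / 2 + (y - pip p / 2) by lra.
  by rewrite -sinp_reflect//; congr sinp; lra.
have d1 : is_derive (pip p - (pip p - x)) 1 (sinp p) ((1 - sinp_fund p x `^ p) `^ p^-1).
  by rewrite subKr; exact: is_derive_sinp.
have d2 : is_derive (pip p - x) 1 (fun y => pip p - y) (0 - 1).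
  exact: is_deriveB.
have [_ d] := @is_derive1_comp _ _ (fun y => pip p - y) _ _ _ d1 d2.
by rewrite (cosp_sinp_fund x)// /cosp derive1E {1}e d; lra.
Qed.

End sinp_theory.

(** Serves outer functions known to be continuous only relative to a segment, where junk values
    beyond the endpoints rule out an argument by continuity at each point. *)
Lemma within_continuous_comp_sub {U V W : topologicalType} (A : set U) (B : set V)
    (f : U -> V) (g : V -> W) :
  f @` A `<=` B -> {within A, continuous f} -> {within B, continuous g} ->
  {within A, continuous (g \o f)}.
Proof.
move=> fAB /subspace_continuousP cf /subspace_continuousP cg.
apply/subspace_continuousP => x Ax.
have fx : B (f x) by apply: fAB; exists x.
apply: cvg_trans (cg _ fx) => Y /= gY.
have h := cf x Ax _ gY; move: h; rewrite /= !nbhs_simpl /= /within /=.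
by apply: (@filterS _ (nbhs x)) => z h Az; apply: h => //; apply: fAB; exists z.
Qed.

(** * Comparing increments through derivatives, without integrating them *)

Section derivative_domination.
Context {R : realType} (f g df dg : R -> R) (a b : R).
Hypothesis ab : a < b.
Hypothesis dfE : forall x, a < x < b -> is_derive x 1 f (df x).
Hypothesis dgE : forall x, a < x < b -> is_derive x 1 g (dg x).
Hypothesis cf : {within `[a, b], continuous f}.
Hypothesis cg : {within `[a, b], continuous g}.

(** The mean value theorem for g - c f; c = 1 and c = -1 give the two one-sided bounds on the
    increment of f. *)
Let MVT_scale (c : R) : exists2 x, a < x < b &
  g b - g a - c * (f b - f a) = (dg x - c * df x) * (b - a).
Proof.
have d x : x \in `]a, b[ ->
    is_derive x 1 (fun y => g y - c * f y) (dg x - c * df x).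
  rewrite in_itv/= => xab; have := dfE x xab; have := dgE x xab => h1 h2.
  by apply: is_derive_eq; rewrite -[_ *: _]/(_ * _); ring.
have cc : {within `[a, b], continuous (fun y => g y - c * f y)}.
  by move=> x; apply: cvgB; [exact: cg|apply: cvgM; [exact: cvg_cst|exact: cf]].
have [x xab e] := MVT ab d cc.
by exists x => //; rewrite -e; ring.
Qed.

Lemma ler_norm_increment : (forall x, a < x < b -> `|df x| <= dg x) ->
  `|f b - f a| <= g b - g a.
Proof.
move=> h; have ba : 0 <= b - a by rewrite subr_ge0 ltW.
have [x xab ex] := MVT_scale 1; have [y yab ey] := MVT_scale (-1).
have /ler_normlP[x1 x2] := h x xab; have /ler_normlP[y1 y2] := h y yab.
have px : 0 <= (dg x - 1 * df x) * (b - a) by rewrite mulr_ge0//; lra.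
have py : 0 <= (dg y - -1 * df y) * (b - a) by rewrite mulr_ge0//; lra.
rewrite -ex in px; rewrite -ey in py.
by apply/ler_normlP; split; lra.
Qed.

Lemma ltr_norm_increment : (forall x, a < x < b -> `|df x| < dg x) ->
  `|f b - f a| < g b - g a.
Proof.
move=> h; have ba : 0 < b - a by rewrite subr_gt0.
have [x xab ex] := MVT_scale 1; have [y yab ey] := MVT_scale (-1).
have /ltr_normlP[x1 x2] := h x xab; have /ltr_normlP[y1 y2] := h y yab.
have px : 0 < (dg x - 1 * df x) * (b - a) by rewrite mulr_gt0//; lra.
have py : 0 < (dg y - -1 * df y) * (b - a) by rewrite mulr_gt0//; lra.
rewrite -ex in px; rewrite -ey in py.
by apply/ltr_normlP; split; lra.
Qed.

End derivative_domination.

Lemma normr_cos_lt1 {R : realType} (t : R) : 0 < t < pi -> `|cos t| < 1.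
Proof.
move=> t0; have s : 0 < sin t by exact: sin_gt0_pi.
have e := cos2Dsin2 t.
rewrite -(ltr_pXn2r (n:=2))// ?nnegrE// expr1n real_normK ?num_real//.
by rewrite -e ltrDl exprn_gt0.
Qed.

Lemma normr_cos_le1 {R : realType} (t : R) : `|cos t| <= 1.
Proof. by rewrite ler_norml cos_geN1 cos_le1. Qed.

(** As g increases on [a, m] and decreases on [m, b], the right-hand side is its total variation,
    and |f'| <= |g'|. Strictness is gained on [a, d], where |c| < 1 and g' > 0. On [m, b] the
    comparison is with -g. *)
Lemma norm_increment_unimodal {R : realType} (f g dg c : R -> R) (a d m b : R) :
  a < d -> d < m -> m < b ->
  (forall x, a < x < b -> is_derive x 1 f (- dg x * c x)) ->
  (forall x, a < x < b -> is_derive x 1 g (dg x)) ->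
  {within `[a, b], continuous f} -> {within `[a, b], continuous g} ->
  (forall x, a < x < m -> 0 < dg x) -> (forall x, m < x < b -> dg x <= 0) ->
  (forall x, `|c x| <= 1) -> (forall x, a < x < d -> `|c x| < 1) ->
  `|f b - f a| < 2 * g m - g a - g b.
Proof.
move=> ad dm mb df dg' cf cg dg0 dg1 c1 c2.
have am := lt_trans ad dm; have db := lt_trans dm mb.
have sub x y z : a <= x -> y <= b -> x < z < y -> a < z < b.
  by move=> ax yb /andP[xz zy]; rewrite (le_lt_trans ax) ?(lt_le_trans zy).
have cW (h : R -> R) x y : {within `[a, b], continuous h} -> a <= x -> y <= b ->
    {within `[x, y], continuous h}.
  by move=> ch ax yb; apply: continuous_subspaceW ch; apply: subset_itv; rewrite bnd_simp.
have I1 : `|f d - f a| < g d - g a.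
  apply: (ltr_norm_increment f g (fun x => - dg x * c x) dg a d ad).
  - by move=> x /(sub _ _ _ (lexx a) (ltW db)); exact: df.
  - by move=> x /(sub _ _ _ (lexx a) (ltW db)); exact: dg'.
  - exact: cW cf (lexx a) (ltW db).
  - exact: cW cg (lexx a) (ltW db).
  - move=> x xad; have /andP[ax xd] := xad.
    have dgx : 0 < dg x by apply: dg0; rewrite ax (lt_trans xd).
    by rewrite normrM normrN (gtr0_norm dgx) gtr_pMr// c2.
have I2 : `|f m - f d| <= g m - g d.
  apply: (ler_norm_increment f g (fun x => - dg x * c x) dg d m dm).
  - by move=> x /(sub _ _ _ (ltW ad) (ltW mb)); exact: df.
  - by move=> x /(sub _ _ _ (ltW ad) (ltW mb)); exact: dg'.
  - exact: cW cf (ltW ad) (ltW mb).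
  - exact: cW cg (ltW ad) (ltW mb).
  - move=> x /andP[dx xm].
    have dgx : 0 < dg x by apply: dg0; rewrite xm (lt_trans ad).
    by rewrite normrM normrN (gtr0_norm dgx) ger_pMr.
have I3 : `|f b - f m| <= - g b - - g m.
  apply: (ler_norm_increment f (fun x => - g x) (fun x => - dg x * c x)
    (fun x => - dg x) m b mb).
  - by move=> x /(sub _ _ _ (ltW am) (lexx b)); exact: df.
  - by move=> x /(sub _ _ _ (ltW am) (lexx b)) h; exact: (is_deriveN (dg' _ h)).
  - exact: cW cf (ltW am) (lexx b).
  - by move=> x; apply: cvgN; exact: (cW _ _ _ cg (ltW am) (lexx b) x).
  - move=> x /dg1 dgx; have ndgx : 0 <= - dg x by rewrite oppr_ge0.
    by rewrite normrM (ger0_norm ndgx) ler_piMr.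
have -> : f b - f a = (f b - f m) + ((f m - f d) + (f d - f a)) by ring.
apply: le_lt_trans (ler_normD _ _) _.
have := ler_normD (f m - f d) (f d - f a); lra.
Qed.

(** * The cosine integral over [0, 1/2], for an arbitrary frequency omega > 0 *)

Section coefficient_bound.
Context {R : realType}.
Variables (p omega : R).
Implicit Types (x y : R).
Hypotheses (p1 : 1 < p) (p2 : p < 2) (omega0 : 0 < omega).
Local Notation mu := (@lebesgue_measure R).

Let p0 : 0 < p. Proof. exact: lt_trans ltr01 p1. Qed.
Let pip0 : 0 < pip p. Proof. exact: pip_gt0. Qed.

(** The change of variable x = psi(y), inverse to y = sin_p(pi_p x) from [0, 1] onto [0, 1/2]. *)
Definition arcsinp_scaled y : R := arcsinp p y / pip p.
Definition sinp_scaled x : R := sinp_fund p (pip p * x).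
(** Equals cos_p(pi_p x) cos(omega x) on ]0, 1/2[. The closed form in place of [cosp] makes
    continuity up to both endpoints accessible. *)
Definition cosp_cos x : R :=
  (1 - sinp_scaled x `^ p) `^ p^-1 * cos (omega * x).
Definition cosp_cos_int x : R := \int[mu]_(t in `[0, x]) cosp_cos t.

Let psi := arcsinp_scaled.
Let C (y : R) : R := (1 - y `^ p) `^ p^-1.
Let K (y : R) : R := y `^ (p - 1) * (1 - y `^ p) `^ ((2 - p) / p).
(** Derivative of [K], factored so that its sign on ]0, 1[ is that of p - 1 - y^p. *)
Let dK (y : R) : R :=
  (p - 1 - y `^ p) * y `^ (p - 2) * (1 - y `^ p) `^ ((2 - p) / p - 1).
(* Boundary terms of the two integrations by parts, minus the primitive. *)
Let D (y : R) : R := omega / pip p * C y * sin (omega * psi y)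
  - K y * cos (omega * psi y) - omega ^+ 2 / pip p * cosp_cos_int (psi y).

(** * The integrand, its primitive and the change of variable *)

Lemma continuous_cosp_cos : {within `[0, 2^-1], continuous cosp_cos}.
Proof.
have c : continuous (fun x : R => cos (omega * x)).
  move=> x; apply: (@continuous_comp _ _ _ (fun x => omega * x) cos).
    exact: mulrl_continuous.
  exact: continuous_cos.
have c1 : {within `[0, 2^-1], continuous (fun x => cos (omega * x))}.
  exact: continuous_subspaceT c.
have c2 : {within `[0, 2^-1], continuous (C \o sinp_scaled)}.
  apply: (within_continuous_comp_sub _ (`[0, 1]%classic : set R) sinp_scaled C).
  - move=> _ [x /= + <-]; rewrite !in_itv/= => /andP[x0 x1].
    apply: sinp_fund_itvcc => //; rewrite mulr_ge0 ?(ltW pip0)//=.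
    by rewrite ler_pM2l.
  - exact: continuous_sinp_fund.
  - by apply: continuous_onem_powR_powR; rewrite // invr_gt0.
by move=> x; apply: cvgM; [exact: c2|exact: c1].
Qed.

Lemma is_derive_cosp_cos_int x : 0 < x < 2^-1 ->
  is_derive x 1 cosp_cos_int (cosp_cos x).
Proof.
move=> /andP[x0 x1].
have i : mu.-integrable `[0, 2^-1] (EFin \o cosp_cos).
  apply: continuous_compact_integrable; first exact: segment_compact.
  exact: continuous_cosp_cos.
have half0 : 0 < (2^-1 : R) by rewrite invr_gt0.
have c : {for x, continuous cosp_cos}.
  by apply: (within_continuous_continuous half0 continuous_cosp_cos); rewrite in_itv/= x0.
have [d <-] := continuous_FTC1_closed x1 i x0 c.
by rewrite derive1E; exact/derivableP.
Qed.

Lemma continuous_cosp_cos_int : {within `[0, 2^-1], continuous cosp_cos_int}.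
Proof.
apply: (parameterized_integral_continuous).
  by rewrite invr_ge0.
apply: continuous_compact_integrable; first exact: segment_compact.
exact: continuous_cosp_cos.
Qed.

Lemma arcsinp_scaled_itvoo y : 0 < y < 1 -> 0 < psi y < 2^-1.
Proof.
move=> /(arcsinp_itvoo _ p1)/andP[a0 a1]; rewrite /psi /arcsinp_scaled.
by rewrite divr_gt0//= ltr_pdivrMr// mulrC.
Qed.

Lemma arcsinp_scaled0 : psi 0 = 0.
Proof. by rewrite /psi /arcsinp_scaled arcsinp0 mul0r. Qed.

Lemma arcsinp_scaled1 : psi 1 = 2^-1.
Proof. by rewrite /psi /arcsinp_scaled arcsinp1// mulrAC divff ?gt_eqF// mul1r. Qed.

Lemma continuous_arcsinp_scaled : {within `[0, 1], continuous psi}.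
Proof.
move=> x; apply: cvgM; last exact: cvg_cst.
exact: continuous_arcsinp.
Qed.

Lemma sinp_scaledK : {in `[0, 1], cancel psi sinp_scaled}.
Proof.
move=> y y01; rewrite /sinp_scaled /psi /arcsinp_scaled mulrC divfK ?gt_eqF//.
exact: sinp_fundK.
Qed.

Lemma cosp_cos_arcsinp y : 0 <= y <= 1 ->
  cosp_cos (psi y) = C y * cos (omega * psi y).
Proof. by move=> y01; rewrite /cosp_cos sinp_scaledK// in_itv. Qed.

(** * Derivatives and continuity of [K] and [D] *)

Lemma is_derive_K y : 0 < y < 1 -> is_derive y 1 K (dK y).
Proof.
move=> y01; have /andP[y0 y1] := y01.
have d1 := is_derive1_powR (p - 1) y0.
have d2 := is_derive_onem_powR_powR p p1 ((2 - p) / p) y y01.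
rewrite /K; apply: is_derive_eq.
rewrite -![_ *: _]/(_ * _) /dK.
have A0 : 0 < 1 - y `^ p by rewrite subr_gt0 powR_lt1// ltW.
(* All powers are expressed through y^(p-2) and (1 - y^p)^((2-p)/p - 1), so that a polynomial
   identity remains. *)
rewrite -(mulr_powRB1 (ltW A0) (divr_gt0 _ p0 : 0 < (2 - p) / p)); last by rewrite subr_gt0.
have -> : p * ((2 - p) / p) = 2 - p by rewrite mulrC divfK ?gt_eqF.
have -> : p - 1 - 1 = p - 2 by lra.
have e1 : y `^ (p - 1) = y * y `^ (p - 2).
  by rewrite -[in LHS](mulr_powRB1 (ltW y0)) ?subr_gt0//; congr (_ * _ `^ _); lra.
have e2 : y `^ p = y * (y * y `^ (p - 2)).
  by rewrite -e1 mulr_powRB1// ltW.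
by rewrite e1 e2; ring.
Qed.

(** The derivative of the sine factor in the first boundary term cancels that of the primitive. The
    remaining sine terms cancel because C' = - K w, with w the integrand of [arcsinp]; only the term
    with [dK] survives. *)
Lemma is_derive_D y : 0 < y < 1 ->
  is_derive y 1 D (- dK y * cos (omega * psi y)).
Proof.
move=> y01; have /andP[y0 y1] := y01.
pose w := (1 - y `^ p) `^ (- p^-1).
have dpsi : is_derive y 1 psi (w / pip p).
  have d := is_derive_arcsinp p p1 y y01.
  by apply: is_derive_eq; rewrite -![_ *: _]/(_ * _) mulr0 add0r mulrC.
have domega : is_derive y 1 (fun x => omega * psi x) (omega * (w / pip p)).
  by apply: is_derive_eq.
have dsin : is_derive y 1 (fun x => sin (omega * psi x))
    (cos (omega * psi y) * (omega * (w / pip p))).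
  exact: (@is_derive1_comp _ sin (fun x => omega * psi x) _ _ _ (is_derive_sin _) domega).
have dcos : is_derive y 1 (fun x => cos (omega * psi x))
    (- sin (omega * psi y) * (omega * (w / pip p))).
  exact: (@is_derive1_comp _ cos (fun x => omega * psi x) _ _ _ (is_derive_cos _) domega).
have dC := is_derive_onem_powR_powR p p1 p^-1 y y01.
have dKy := is_derive_K y y01.
have dint : is_derive y 1 (fun x => cosp_cos_int (psi x))
    (C y * cos (omega * psi y) * (w / pip p)).
  rewrite -cosp_cos_arcsinp ?ltW//.
  exact: (@is_derive1_comp _ cosp_cos_int psi _ _ _
    (is_derive_cosp_cos_int _ (arcsinp_scaled_itvoo y y01)) dpsi).
apply: is_derive_eq.
rewrite -![_ *: _]/(_ * _) /=.
have A0 : 0 < 1 - y `^ p by rewrite subr_gt0 powR_lt1// ltW.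
(* The exponents add up as (2 - p)/p - 1/p = 1/p - 1. *)
have eKw : K y * w = y `^ (p - 1) * (1 - y `^ p) `^ (p^-1 - 1).
  rewrite /K /w -mulrA -powRD; last by rewrite (gt_eqF A0) implybT.
  by congr (_ * _ `^ _); field; rewrite gt_eqF.
transitivity (- dK y * cos (omega * psi y) + omega / pip p * sin (omega * psi y) *
    (K y * w - y `^ (p - 1) * (1 - y `^ p) `^ (p^-1 - 1))).
  by rewrite divff ?gt_eqF//; field; rewrite gt_eqF.
by rewrite eKw subrr mulr0 addr0.
Qed.

Lemma continuous_K : {within `[0, 1], continuous K}.
Proof.
move=> y; apply: cvgM.
  by apply: continuous_powR_itv; rewrite subr_gt0.
by apply: continuous_onem_powR_powR; rewrite // divr_gt0// subr_gt0.
Qed.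

Lemma continuous_D : {within `[0, 1], continuous D}.
Proof.
have cpsi := continuous_arcsinp_scaled.
have comega : {within `[0, 1], continuous (fun y => omega * psi y)}.
  by move=> y; apply: cvgM; [exact: cvg_cst|exact: cpsi].
have ccos : {within `[0, 1], continuous (fun y => cos (omega * psi y))}.
  by apply: within_continuous_comp comega => y _; exact: continuous_cos.
have csin : {within `[0, 1], continuous (fun y => sin (omega * psi y))}.
  by apply: within_continuous_comp comega => y _; exact: continuous_sin.
have cint : {within `[0, 1], continuous (cosp_cos_int \o psi)}.
  apply: (within_continuous_comp_sub _ (`[0, 2^-1]%classic : set R) psi cosp_cos_int).
  - move=> _ [x /= + <-]; rewrite !in_itv/= !le_eqVlt.
    have h0 : 0 < 2^-1 :> R by rewrite invr_gt0.
    case/andP=> /predU1P[<- _|x0 /predU1P[->|x1]].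
    + by rewrite arcsinp_scaled0 eqxx h0 orbT.
    + by rewrite arcsinp_scaled1 eqxx h0 orbT.
    + by have /andP[-> ->] := arcsinp_scaled_itvoo x (introT andP (conj x0 x1));
      rewrite !orbT.
  - exact: cpsi.
  - exact: continuous_cosp_cos_int.
have cC : {within `[0, 1], continuous C}.
  by apply: continuous_onem_powR_powR; rewrite // invr_gt0.
move=> y; apply: cvgB; first apply: cvgB.
- by apply: cvgM; [apply: cvgM; [exact: cvg_cst|exact: cC]|exact: csin].
- by apply: cvgM; [exact: continuous_K|exact: ccos].
- by apply: cvgM; [exact: cvg_cst|exact: cint].
Qed.

(** * The maximum of [K] and the strict bound over the half interval *)

Definition argmax_K : R := (p - 1) `^ p^-1.
Let y0 := argmax_K.

Lemma argmax_K_powR : y0 `^ p = p - 1.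
Proof. by rewrite /y0 /argmax_K -powRrM mulVf ?gt_eqF// powRr1// subr_ge0 ltW. Qed.

Lemma K_argmax : K y0 = cp p.
Proof.
rewrite /K argmax_K_powR /y0 /argmax_K -powRrM /cp.
congr (_ `^ _ * _ `^ _); first exact: mulrC.
by ring.
Qed.

Lemma argmax_K_itvoo : 0 < y0 < 1.
Proof.
have p10 : 0 < p - 1 by rewrite subr_gt0.
rewrite powR_gt0//=; have [//|y1] := ltP y0 1.
(* If y0 >= 1, then p - 1 = y0^p >= 1, contradicting p < 2. *)
have : 1 `^ p <= y0 `^ p by rewrite ge0_ler_powR ?nnegrE ?powR_ge0// ltW.
rewrite argmax_K_powR powR1 => h; have : 2 <= p by lra.
by rewrite leNgt p2.
Qed.

Lemma norm_D1_lt : `|D 1 - D 0| < 2 * cp p.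
Proof.
have /andP[y0_gt0 y0_lt1] := argmax_K_itvoo.
(* Half of this minimum is F_p(d) for a point d that lies below y0 and satisfies 0 < omega psi(y) <
   pi for 0 < y < d, so the cosine is strictly smaller than 1 in absolute value there. *)
pose x1 := Num.min (arcsinp p y0) (pip p * (pi / omega)).
have /andP[ay0 ay1] := arcsinp_itvoo p p1 y0 argmax_K_itvoo.
have x1_gt0 : 0 < x1.
  by rewrite lt_min ay0 mulr_gt0// divr_gt0// pi_gt0.
have x1a : x1 <= arcsinp p y0 by rewrite ge_min lexx.
have x1b : x1 <= pip p * (pi / omega) by rewrite ge_min lexx orbT.
have x01 : 0 < x1 / 2 < pip p / 2 by apply/andP; split; lra.
pose d := sinp_fund p (x1 / 2).
have [/andP[d0 d1] dE] := sinp_fund_itvoo p p1 _ x01.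
rewrite -/d in d0 d1 dE.
have d01 : d \in `[0, 1] by rewrite in_itv/= (ltW d0) (ltW d1).
have y01 : y0 \in `[0, 1] by rewrite in_itv/= (ltW y0_gt0) (ltW y0_lt1).
have dy0 : d < y0.
  rewrite ltNge; apply/negP; rewrite le_eqVlt => /predU1P[y0d|y0d].
    by move: dE; rewrite -y0d; lra.
  by have := ltr_arcsinp p p1 y0 d y01 d01 y0d; rewrite dE; lra.
have dK_pos y : 0 < y < y0 -> 0 < dK y.
  move=> /andP[y_gt0 yy0]; rewrite !mulr_gt0 ?powR_gt0 ?subr_gt0//.
    by rewrite -argmax_K_powR gt0_ltr_powR ?nnegrE// ltW.
  by rewrite powR_lt1// (ltW y_gt0) (lt_trans yy0).
have dK_neg y : y0 < y < 1 -> 0 <= - dK y.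
  move=> /andP[y0y y_lt1]; rewrite -mulNr -mulNr !mulr_ge0 ?powR_ge0//.
  rewrite oppr_ge0 subr_le0 -argmax_K_powR ge0_ler_powR ?nnegrE
    ?(ltW p0) ?(ltW y0y) ?(ltW y0_gt0)//.
  exact: ltW (lt_trans y0_gt0 y0y).
have psid y : 0 < y < d -> 0 < omega * psi y < pi.
  move=> /andP[y0' yd].
  have /andP[q0 _] := arcsinp_scaled_itvoo y (introT andP (conj y0' (lt_trans yd d1))).
  rewrite mulr_gt0//= mulrC -ltr_pdivlMr// ltr_pdivrMr// mulrC.
  have yin : y \in `[0, 1] by rewrite in_itv/= (ltW y0') (ltW (lt_trans yd d1)).
  by have := ltr_arcsinp p p1 y d yin d01 yd; rewrite dE; lra.
(* Both exponents p - 1 and (2 - p)/p are nonzero, so the convention that 0 to the power 0 is 1 does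
   not interfere at either endpoint. *)
have K0 : K 0 = 0.
  by rewrite /K powR0 ?mul0r// subr_eq0 gt_eqF.
have K1 : K 1 = 0.
  by rewrite /K !powR1 subrr powR0 ?mulr0// mulf_neq0// ?invr_eq0 ?subr_eq0 gt_eqF.
have -> : 2 * cp p = 2 * K y0 - K 0 - K 1 by rewrite K0 K1 K_argmax !subr0.
apply: (norm_increment_unimodal D K dK (fun y => cos (omega * psi y))
  0 d y0 1 d0 dy0 y0_lt1
  is_derive_D is_derive_K continuous_D continuous_K dK_pos).
- by move=> y /dK_neg; rewrite oppr_ge0.
- by move=> y; exact: normr_cos_le1.
- by move=> y /psid; exact: normr_cos_lt1.
Qed.

(** [D] vanishes at 0; at 1 both boundary terms vanish with [C] and [K], leaving -(omega^2 / pi_p)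
    times the integral. The bound on the increment of [D] is then divided by omega^2 / pi_p. *)
Lemma norm_cosp_cos_int_half :
  `|cosp_cos_int 2^-1| < 2 * pip p / omega ^+ 2 * cp p.
Proof.
have := norm_D1_lt.
have D0 : D 0 = 0.
  rewrite /D arcsinp_scaled0 mulr0 sin0 mulr0 /K powR0 ?subr_eq0 ?gt_eqF//.
  by rewrite /cosp_cos_int set_itv1 Rintegral_set1 !(mulr0, mul0r, subr0).
have D1 : D 1 = - (omega ^+ 2 / pip p * cosp_cos_int 2^-1).
  rewrite /D arcsinp_scaled1 /C /K !powR1 subrr !powR0 ?gt_eqF ?divr_gt0
    ?invr_gt0 ?subr_gt0//.
  by rewrite !mulr0 !mul0r subrr sub0r.
have k0 : 0 < omega ^+ 2 / pip p by rewrite divr_gt0 ?exprn_gt0.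
rewrite D0 D1 subr0 normrN normrM (gtr0_norm k0) -ltr_pdivlMl// invf_div => h.
by apply: lt_le_trans h _; rewrite le_eqVlt; apply/orP; left; apply/eqP; ring.
Qed.

End coefficient_bound.

(** * Integrals of functions known only inside subintervals *)

Section piecewise_integral.
Context {R : realType}.
Local Notation mu := (@lebesgue_measure R).

(** Meant for [cosp], whose formula is proved only inside open intervals: the two endpoints affect
    neither measurability nor the integral. *)
Lemma integral_eq_itvoo (a b : R) (f g : R -> R) :
  (forall x, a < x < b -> f x = g x) -> mu.-integrable `[a, b] (EFin \o g) ->
  measurable_fun `[a, b] f /\
  (\int[mu]_(x in `[a, b]) (f x)%:E = (\int[mu]_(x in `[a, b]) g x)%:E)%E.
Proof.
move=> fg ig.
have mg : measurable_fun `[a, b] g by move/integrableP : ig => [/measurable_EFinP].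
have goo : measurable_fun `]a, b[ g.
  by apply/measurable_fun_itv_obnd_cbndP/measurable_fun_itv_bndo_bndcP.
have foo : measurable_fun `]a, b[ f.
  by apply: eq_measurable_fun goo => x; rewrite inE/= in_itv/= => /fg.
have fco : measurable_fun `[a, b[ f by apply/measurable_fun_itv_obnd_cbndP.
have gco : measurable_fun `[a, b[ g by apply/measurable_fun_itv_bndo_bndcP.
split; first exact/measurable_fun_itv_bndo_bndcP.
rewrite /Rintegral fineK; last exact: integrable_fin_num.
rewrite -!integral_itv_bndo_bndc; try exact/measurable_EFinP.
rewrite -!integral_itv_obnd_cbnd; try exact/measurable_EFinP.
by apply: eq_integral => x; rewrite inE/= in_itv/= => /fg ->.
Qed.

Lemma Rintegral_glue (a c b : R) (f g1 g2 : R -> R) : a < c -> c < b ->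
  (forall x, a < x < c -> f x = g1 x) -> (forall x, c < x < b -> f x = g2 x) ->
  mu.-integrable `[a, c] (EFin \o g1) -> mu.-integrable `[c, b] (EFin \o g2) ->
  \int[mu]_(x in `[a, b]) f x =
  \int[mu]_(x in `[a, c]) g1 x + \int[mu]_(x in `[c, b]) g2 x.
Proof.
move=> ac cb fg1 fg2 i1 i2.
have [m1 e1] := integral_eq_itvoo _ _ _ _ fg1 i1.
have [m2 e2] := integral_eq_itvoo _ _ _ _ fg2 i2.
have m2' : measurable_fun `]c, b] f by apply/measurable_fun_itv_obnd_cbndP.
(* The point c goes to the left piece only, which makes the union disjoint. *)
have U : `[a, b]%classic = (`[a, c] `|` `]c, b])%classic.
  by rewrite -itv_bndbnd_setU// bnd_simp ltW.
rewrite {1}/Rintegral U integral_setU//=.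
- rewrite [X in (_ + X)%E]integral_itv_obnd_cbnd; last exact/measurable_EFinP.
  by rewrite e1 e2.
- by apply/measurable_EFinP; rewrite measurable_funU.
- apply/disj_setPS => y [/=]; rewrite !in_itv/= => /andP[_ yc] /andP[].
  by rewrite ltNge yc.
Qed.
End piecewise_integral.

(** * Symmetry about 1/2 and the final estimate *)

Lemma cos_onem_natpi {R : realType} (j : nat) (x : R) :
  cos (j%:R * pi * (1 - x)) = (-1) ^+ j * cos (j%:R * pi * x).
Proof.
have -> : j%:R * pi * (1 - x) = - (j%:R * pi * x) + pi *+ j.
  by rewrite -mulr_natl; ring.
by rewrite (alternatingn (@cosDpi R)) cosN.
Qed.

(** Under x -> 1 - x the factor cos_p(pi_p x) changes sign and cos(j pi x) is multiplied by (-1)^j,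
    so [1/2, 1] contributes -(-1)^j times the integral over [0, 1/2]. *)
Lemma bcoef_split {R : realType} (p : R) (j : nat) : 1 < p -> (1 <= j)%N ->
  bcoef j p = 2 * (1 - (-1) ^+ j) * cosp_cos_int p (j%:R * pi) 2^-1.
Proof.
move=> p1 j1.
have pip0 := pip_gt0 p p1.
have half : 0 < (2^-1 : R) < 1 by rewrite invr_gt0 ltr0n/= invf_lt1 ?ltr1n.
have /andP[h0 h1] := half.
have w0 : 0 < j%:R * pi :> R by rewrite mulr_gt0 ?pi_gt0 ?ltr0n.
pose g := cosp_cos p (j%:R * pi).
pose g2 x := - (-1) ^+ j * g (1 - x).
have cg : {within `[0, 2^-1], continuous g} by exact: continuous_cosp_cos.
have cg2 : {within `[2^-1, 1], continuous g2}.
  suff c : {within `[2^-1, 1], continuous (g \o (fun x => 1 - x))}.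
    by move=> x; apply: cvgM; [exact: cvg_cst|exact: c].
  apply: (within_continuous_comp_sub (`[2^-1, 1]%classic : set R)
    (`[0, 2^-1]%classic : set R) (fun x => 1 - x) g).
  - by move=> _ [x /= + <-]; rewrite !in_itv/= => /andP[x0 x1]; apply/andP; split; lra.
  - by apply: continuous_subspaceT => x; apply: cvgB; [exact: cvg_cst|exact: cvg_id].
  - exact: cg.
have cospE x : 0 < x < 2^-1 -> cosp p (pip p * x) * cos (j%:R * pi * x) = g x.
  move=> /andP[x0 x1]; rewrite cosp_sinp_fund//.
  by rewrite mulr_gt0//= ltr_pM2l.
rewrite /bcoef (@Rintegral_glue _ 0 2^-1 1 _ g g2)//.
- have -> : \int[lebesgue_measure]_(x in `[2^-1, 1]) g2 x =
      - (-1) ^+ j * cosp_cos_int p (j%:R * pi) 2^-1.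
    rewrite /cosp_cos_int -RintegralZl//; last first.
      by apply: continuous_compact_integrable => //; exact: segment_compact.
    have half1 : 1 - 2^-1 = 2^-1 :> R by lra.
    (* The lower endpoint is written as 1 - 1/2 to fit the substitution x -> 1 - x. *)
    rewrite -[X in `[X, 1]]half1; symmetry.
    apply: (@Rintegration_by_substitution_onem _ (fun x => - (-1) ^+ j * g x) 2^-1).
      by rewrite (ltW h0) (ltW h1).
    by move=> x; apply: cvgM; [exact: cvg_cst|exact: cg].
  by rewrite /cosp_cos_int -/g; ring.
- move=> x /andP[x0 x1].
  have x01 : 0 < 1 - x < 2^-1 by apply/andP; split; lra.
  rewrite /g2 -cospE// cos_onem_natpi.
  have -> : pip p * x = pip p - pip p * (1 - x) by ring.
  rewrite cosp_reflect//; last first.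
    by have /andP[a b] := x01; rewrite mulr_gt0//= ltr_pM2l.
  have s2 : (-1) ^+ j * (-1) ^+ j = 1 :> R by rewrite -expr2 sqrr_sign.
  set c := cosp _ _; set e := cos _; set s := (-1) ^+ j in s2 *.
  transitivity (- (s * s) * (c * e)); [by rewrite s2; ring|ring].
- by apply: continuous_compact_integrable => //; exact: segment_compact.
- by apply: continuous_compact_integrable => //; exact: segment_compact.
Qed.

Theorem lemma6 (R : realType) (p : R) (hp1 : 1 < p) (hp2 : p < 2) (j : nat)
    (hj : (1 <= j)%N) :
  `|bcoef j p| < 8 * pip p / (j%:R ^+ 2 * pi ^+ 2) * cp p.
Proof.
have w0 : 0 < j%:R * pi :> R by rewrite mulr_gt0 ?pi_gt0 ?ltr0n.
have := norm_cosp_cos_int_half p (j%:R * pi) hp1 hp2 w0.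
rewrite bcoef_split// exprMn; set I := cosp_cos_int _ _ _ => hI.
rewrite !normrM.
(* The normalising 2 times at most 2 from the two halves; with the 2 of the half-interval bound this
   makes the constant 8. *)
have n4 : `|2 : R| * `|1 - (-1) ^+ j : R| <= 4.
  rewrite gtr0_norm//.
  have := ler_normB (1 : R) ((-1) ^+ j); rewrite normr1 normr_sign; lra.
apply: (@le_lt_trans _ _ (4 * `|I|)); first by rewrite ler_wpM2r.
rewrite [ltRHS](_ : _ = 4 * (2 * pip p / (j%:R ^+ 2 * pi ^+ 2) * cp p)); last by ring.
by rewrite ltr_pM2l.
Qed.
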